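(* Let $\vec r(u,v)$, $(u,v)\in D$, be a surface of class $C^3$ in $\mathbb{R}^3$ with regular coordinate net ($\vec r_u\wedge\vec r_v\neq\vec 0$), and let $u=u(t)$, $v=v(t)$, $t_0<t<t_1$, be a $C^3$ curve on the surface such that, with primes denoting $d/dt$ of $t\mapsto\vec r(u(t),v(t))$, $(\vec r'\wedge\vec r'')\cdot\vec r'''\neq0$ for all $t\in(t_0,t_1)$. Fix $t\in(t_0,t_1)$, let $P=\vec r(u(t),v(t))$, and for sufficiently small $\Delta t>0$ let $Q=Q(\Delta t)=\vec r(u(t+\Delta t),v(t+\Delta t))$ be the moving point on the curve near $P$. Let $\mathcal{D}_P=|\overrightarrow{PQ}|$. Then, for $\Delta t>0$, $$\begin{aligned}\frac{d\mathcal{D}_P}{d\Delta t}=&|\vec r(u(t+\Delta t),v(t+\Delta t))-\vec r(u(t),v(t))|^{-1}\,[\vec r(u(t+\Delta t),v(t+\Delta t))-\vec r(u(t),v(t))]\\&\cdot[\vec r_u(u(t+\Delta t),v(t+\Delta t))u'(t+\Delta t)+\vec r_v(u(t+\Delta t),v(t+\Delta t))v'(t+\Delta t)],\end{aligned}$$ and $$\mathcal{D}_{P+}'(0)=|\vec r_u(u(t),v(t))u'(t)+\vec r_v(u(t),v(t))v'(t)|.$$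
   Context: $\wedge$ and $\cdot$ are cross and dot product. $\mathcal{D}_P(0)=0$ and $\mathcal{D}_{P+}'(0)=\lim_{\Delta t\to0^+}\frac{\mathcal{D}_P(\Delta t)-\mathcal{D}_P(0)}{\Delta t}$ is the right derivative at $0$. *)

(* Defs.v *)
From Stdlib Require Import Reals.
From Coquelicot Require Import Coquelicot.
Open Scope R_scope.

Definition R3 : Type := (R * R * R)%type.

Definition c1 (a : R3) : R := fst (fst a).
Definition c2 (a : R3) : R := snd (fst a).
Definition c3 (a : R3) : R := snd a.

Definition dot (a b : R3) : R :=
  c1 a * c1 b + c2 a * c2 b + c3 a * c3 b.

Definition cross (a b : R3) : R3 :=
  (c2 a * c3 b - c3 a * c2 b,
   c3 a * c1 b - c1 a * c3 b,
   c1 a * c2 b - c2 a * c1 b).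

Definition length3 (a : R3) : R := sqrt (dot a a).

Definition plus3 (a b : R3) : R3 := plus a b.
Definition minus3 (a b : R3) : R3 := minus a b.
Definition scal3 (k : R) (a : R3) : R3 := scal k a.
Definition zero3 : R3 := zero.

(* Orders below [n] are listed explicitly: [Derive_n] is total, so
   [ex_derive_n f n] alone says nothing about the lower derivatives. *)
Definition Cn_on_interval (n : nat) (f : R -> R) (a b : R) : Prop :=
  forall (k : nat) (s : R), (k <= n)%nat -> a < s < b ->
    ex_derive_n f k s /\ continuous (Derive_n f k) s.

(* [ex_diff_n f n x y] asks that all iterated partial derivatives of [f] up to
   order [n] exist and be continuous at [(x, y)]; imposed at every point of an
   open set it is the usual class C^n. *)
Definition Cn_surface (n : nat) (r : R -> R -> R3) (D : R * R -> Prop) : Prop :=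
  forall a b : R, D (a, b) ->
    ex_diff_n (fun x y => c1 (r x y)) n a b /\
    ex_diff_n (fun x y => c2 (r x y)) n a b /\
    ex_diff_n (fun x y => c3 (r x y)) n a b.

Definition partial_u (r : R -> R -> R3) (a b : R) : R3 :=
  (Derive (fun x => c1 (r x b)) a,
   Derive (fun x => c2 (r x b)) a,
   Derive (fun x => c3 (r x b)) a).

Definition partial_v (r : R -> R -> R3) (a b : R) : R3 :=
  (Derive (fun y => c1 (r a y)) b,
   Derive (fun y => c2 (r a y)) b,
   Derive (fun y => c3 (r a y)) b).

Definition regular_net (r : R -> R -> R3) (D : R * R -> Prop) : Prop :=
  forall a b : R, D (a, b) ->
    cross (partial_u r a b) (partial_v r a b) <> zero3.

Definition curve_on (r : R -> R -> R3) (u v : R -> R) (s : R) : R3 :=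
  r (u s) (v s).

Definition curve_derive_n (g : R -> R3) (k : nat) (s : R) : R3 :=
  (Derive_n (fun x => c1 (g x)) k s,
   Derive_n (fun x => c2 (g x)) k s,
   Derive_n (fun x => c3 (g x)) k s).

(* The chord vector from P = g t to Q = g (t + h), and its length. *)
Definition PQ (g : R -> R3) (t h : R) : R3 := minus3 (g (t + h)) (g t).

Definition dist_P (g : R -> R3) (t h : R) : R := length3 (PQ g t h).

Definition is_right_derive (f : R -> R) (x l : R) : Prop :=
  filterlim (fun h => (f (x + h) - f x) / h) (at_right 0) (locally l).

(* Main.v *)
From Stdlib Require Import Reals Lra Lia.
From Coquelicot Require Import Coquelicot.
Require Import Defs.
Open Scope R_scope.

(** The nonvanishing triple product forces [r'(t)] to be nonzero. The quotient
    [|PQ| / h] is the length of the difference quotient of the curve, so it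
    tends to [|r'(t)|] as [h] decreases to [0]. This is the one-sided derivative
    at [0], and since the limit is positive, it also shows that [Q] differs from
    [P] for small [h > 0]; there the square root can be differentiated. *)

Lemma filterlim_at_right_diff_quotient (f : R -> R) (t l : R) :
  is_derive f t l ->
  filterlim (fun h => (f (t + h) - f t) / h) (at_right 0) (locally l).
Proof.
  intros Hf; apply is_derive_Reals in Hf.
  apply filterlim_locally; intros eps.
  destruct (Hf eps (cond_pos eps)) as [d Hd].
  exists d; intros h Hh Hpos.
  apply Hd; [lra|].
  replace h with (h - 0) by ring; exact Hh.
Qed.

(** Stated by coordinates, as in [curve_derive_n], so that the calculus of real functions applies to
    each coordinate. *)
Definition is_derive3 (g : R -> R3) (s : R) (w : R3) : Prop :=
  is_derive (fun x => c1 (g x)) s (c1 w) /\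
  is_derive (fun x => c2 (g x)) s (c2 w) /\
  is_derive (fun x => c3 (g x)) s (c3 w).

(** Carries the triple product hypothesis, phrased with [Derive_n], over to the explicit chain rule
    vector. *)
Lemma curve_derive_1_unique (g : R -> R3) (s : R) (w : R3) :
  is_derive3 g s w -> curve_derive_n g 1 s = w.
Proof.
  intros (H1 & H2 & H3); destruct w as [[w1 w2] w3].
  unfold curve_derive_n; simpl.
  f_equal; [f_equal|]; now apply is_derive_unique.
Qed.

Lemma dot_ge0 (a : R3) : 0 <= dot a a.
Proof. unfold dot; nra. Qed.

Lemma dot_gt0 (a : R3) : a <> zero3 -> 0 < dot a a.
Proof.
  destruct a as [[x y] z]; intros Ha.
  destruct (Rle_lt_or_eq_dec _ _ (dot_ge0 (x, y, z))) as [H | H]; [exact H|].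
  unfold dot, c1, c2, c3 in H; simpl in H.
  exfalso; apply Ha.
  replace x with 0 by nra; replace y with 0 by nra; replace z with 0 by nra.
  reflexivity.
Qed.

Lemma length3_zero : length3 zero3 = 0.
Proof.
  change zero3 with ((0, 0, 0) : R3); unfold length3, dot, c1, c2, c3; simpl.
  replace (0 * 0 + 0 * 0 + 0 * 0) with 0 by ring; apply sqrt_0.
Qed.

(** The sign of [k] is where one-sidedness enters: a negative factor would come out of the square
    root as [- k]. *)
Lemma length3_scal (k : R) (a : R3) :
  0 <= k -> length3 (scal3 k a) = k * length3 a.
Proof.
  intros Hk; unfold length3.
  replace (dot (scal3 k a) (scal3 k a)) with (k * k * dot a a)
    by (unfold dot, scal3, c1, c2, c3, scal; simpl;
        unfold prod_scal, scal; simpl; unfold mult; simpl; ring).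
  rewrite sqrt_mult_alt by nra; now rewrite sqrt_square.
Qed.

Lemma cross_zero_l (b : R3) : cross zero3 b = zero3.
Proof.
  change zero3 with ((0, 0, 0) : R3); unfold cross, c1, c2, c3; simpl.
  f_equal; [f_equal|]; ring.
Qed.

Lemma dot_zero_l (b : R3) : dot zero3 b = 0.
Proof.
  change zero3 with ((0, 0, 0) : R3); unfold dot, c1, c2, c3; simpl; ring.
Qed.

Lemma dist_P_0 (g : R -> R3) (t : R) : dist_P g t 0 = 0.
Proof.
  unfold dist_P, PQ, minus3; rewrite Rplus_0_r, minus_eq_zero.
  apply length3_zero.
Qed.

Lemma dist_P_right_derive (g : R -> R3) (t : R) (w : R3) :
  is_derive3 g t w -> is_right_derive (dist_P g t) 0 (length3 w).
Proof.
  intros (H1 & H2 & H3); unfold is_right_derive.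
  apply filterlim_at_right_diff_quotient in H1, H2, H3.
  set (q1 := fun h => (c1 (g (t + h)) - c1 (g t)) / h) in H1.
  set (q2 := fun h => (c2 (g (t + h)) - c2 (g t)) / h) in H2.
  set (q3 := fun h => (c3 (g (t + h)) - c3 (g t)) / h) in H3.
  apply filterlim_ext_loc
    with (fun h => sqrt (q1 h * q1 h + q2 h * q2 h + q3 h * q3 h)).
  (* The radius is arbitrary: the two functions agree at every [h > 0]. *)
  - exists (mkposreal 1 Rlt_0_1); intros h _ Hh.
    rewrite Rplus_0_l, dist_P_0, Rminus_0_r.
    unfold dist_P; replace (PQ g t h) with (scal3 h (q1 h, q2 h, q3 h)).
    + rewrite length3_scal by lra.
      unfold length3, dot, c1, c2, c3; simpl; field; lra.
    + unfold q1, q2, q3, scal3, scal, PQ, minus3, minus, plus, opp, c1, c2, c3.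
      destruct (g (t + h)) as [[a1 a2] a3], (g t) as [[b1 b2] b3]; simpl.
      (* [R3] is a pair whose first component is a pair, so each operation unfolds once per
         level. *)
      unfold prod_scal, scal; simpl; unfold prod_scal, scal; simpl.
      unfold mult, prod_plus, prod_opp, plus, opp; simpl.
      unfold prod_plus, prod_opp, plus, opp; simpl.
      f_equal; [f_equal|]; field; lra.
  - assert (Hsq : forall (q : R -> R) l,
      filterlim q (at_right 0) (locally l) ->
      filterlim (fun h => q h * q h) (at_right 0) (locally (l * l))).
    { intros q l Hq.
      exact (filterlim_comp_2 q q Rmult Hq Hq (filterlim_mult l l)). }
    apply (filterlim_comp _ _ _ _ sqrt _ (locally (dot w w))).
    + unfold dot.
      refine (filterlim_comp_2 _ _ Rplus _ (Hsq _ _ H3) (filterlim_plus _ _)).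
      exact (filterlim_comp_2 _ _ Rplus (Hsq _ _ H1) (Hsq _ _ H2)
               (filterlim_plus _ _)).
    (* [sqrt] is continuous on the closed half-line, so [w = zero3] is covered too. *)
    + apply continuity_pt_filterlim, continuity_pt_sqrt, dot_ge0.
Qed.

(** The squared distance is a sum of three squares of coordinate differences, hence differentiable;
    it is positive when Q differs from P, so the chain rule for [sqrt] applies. *)
Lemma dist_P_derive (g : R -> R3) (t h : R) (w : R3) :
  is_derive3 g (t + h) w -> PQ g t h <> zero3 ->
  is_derive (dist_P g t) h (/ length3 (PQ g t h) * dot (PQ g t h) w).
Proof.
  intros (H1 & H2 & H3) Hne; pose proof (dot_gt0 _ Hne) as Hpos.
  assert (Hc : forall (f : R -> R) l, is_derive f (t + h) l ->
    is_derive (fun k => (f (t + k) - f t) * (f (t + k) - f t)) h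
      (2 * (f (t + h) - f t) * l)).
  { intros f l Hf.
    pose proof (is_derive_unique f (t + h) l Hf) as Hl.
    assert (ex_derive f (t + h)) by (exists l; exact Hf).
    auto_derive; [tauto|].
    change (Derive (fun x => f x) (t + h)) with (Derive f (t + h)).
    rewrite Hl; ring. }
  assert (Hd : is_derive (fun k => dot (PQ g t k) (PQ g t k)) h
                 (2 * dot (PQ g t h) w)).
  { replace (2 * dot (PQ g t h) w) with
      (2 * (c1 (g (t + h)) - c1 (g t)) * c1 w
       + 2 * (c2 (g (t + h)) - c2 (g t)) * c2 w
       + 2 * (c3 (g (t + h)) - c3 (g t)) * c3 w).
    - exact (is_derive_plus _ _ _ _ _
               (is_derive_plus _ _ _ _ _ (Hc _ _ H1) (Hc _ _ H2)) (Hc _ _ H3)).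
    - unfold dot, PQ, minus3, minus, plus, opp, c1, c2, c3; simpl.
      unfold plus, opp; simpl; ring. }
  pose proof (is_derive_sqrt _ _ _ Hd Hpos) as Hs.
  replace (/ length3 (PQ g t h) * dot (PQ g t h) w)
    with (2 * dot (PQ g t h) w / (2 * sqrt (dot (PQ g t h) (PQ g t h)))).
  - exact Hs.
  - unfold length3; field; apply Rgt_not_eq, sqrt_lt_R0, Hpos.
Qed.

Lemma eventually_PQ_neq0 (g : R -> R3) (t : R) (w : R3) :
  is_derive3 g t w -> w <> zero3 ->
  at_right 0 (fun h => PQ g t h <> zero3).
Proof.
  intros Hg Hw.
  assert (Hpos : 0 < length3 w) by (apply sqrt_lt_R0, dot_gt0, Hw).
  pose proof (dist_P_right_derive g t w Hg _ (open_gt 0 _ Hpos)) as Hev.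
  unfold filtermap in Hev; revert Hev; apply filter_imp; intros h Hh H0.
  (* If Q were P, the difference quotient would be 0, although it is positive near its positive
     limit. *)
  revert Hh; rewrite Rplus_0_l, dist_P_0; unfold dist_P.
  rewrite H0, length3_zero; unfold Rdiv; lra.
Qed.

(** Total differentiability at a point follows when one partial derivative exists nearby and is
    continuous at the point, and the other exists at the point. The chain rule then applies. *)
Lemma is_derive_comp_2d (f : R -> R -> R) (u v : R -> R) (s : R) :
  locally (u s, v s)
    (fun z : R * R => ex_derive (fun x => f x (snd z)) (fst z)) ->
  ex_derive (fun y => f (u s) y) (v s) ->
  continuity_2d_pt (fun x y => Derive (fun z => f z y) x) (u s) (v s) ->
  ex_derive u s -> ex_derive v s ->
  is_derive (fun x => f (u x) (v x)) s
    (Derive u s * Derive (fun x => f x (v s)) (u s)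
     + Derive v s * Derive (fun y => f (u s) y) (v s)).
Proof.
  intros Hx Hy Hc Hu Hv.
  rewrite (Rmult_comm (Derive u s)), (Rmult_comm (Derive v s)).
  apply is_derive_Reals, derivable_pt_lim_comp_2d.
  - apply filterdiff_differentiable_pt_lim.
    apply (is_derive_filterdiff f (u s) (v s)
             (fun x y => Derive (fun z => f z y) x)).
    + revert Hx; apply filter_imp; intros z Hz; now apply Derive_correct.
    + now apply Derive_correct.
    + now apply continuity_2d_pt_filterlim in Hc.
  - now apply is_derive_Reals, Derive_correct.
  - now apply is_derive_Reals, Derive_correct.
Qed.

Lemma is_derive_comp_ex_diff_n (f : R -> R -> R) (n : nat) (D : R * R -> Prop)
  (u v : R -> R) (s : R) :
  open D -> (forall a b, D (a, b) -> ex_diff_n f (S n) a b) ->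
  D (u s, v s) -> ex_derive u s -> ex_derive v s ->
  is_derive (fun x => f (u x) (v x)) s
    (Derive u s * Derive (fun x => f x (v s)) (u s)
     + Derive v s * Derive (fun y => f (u s) y) (v s)).
Proof.
  intros HD Hf Hs Hu Hv; destruct (Hf _ _ Hs) as (_ & _ & Hy & Hxn & _).
  apply is_derive_comp_2d; trivial.
  (* Openness of [D] turns existence of the partial derivative on [D] into existence on a
     neighbourhood. *)
  - apply filter_imp with (2 := HD _ Hs); intros [a b] Hab.
    exact (proj1 (proj2 (Hf _ _ Hab))).
  (* Continuity is the first conjunct of [ex_diff_n] at every order; the case split lets the
     fixpoint reduce. *)
  - destruct n; apply Hxn.
Qed.

Lemma curve_on_derive (n : nat) (D : R * R -> Prop) (r : R -> R -> R3)
  (u v : R -> R) (s : R) :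
  open D -> Cn_surface (S n) r D -> D (u s, v s) ->
  ex_derive u s -> ex_derive v s ->
  is_derive3 (curve_on r u v) s
    (plus3 (scal3 (Derive u s) (partial_u r (u s) (v s)))
           (scal3 (Derive v s) (partial_v r (u s) (v s)))).
Proof.
  intros HD Hr Hs Hu Hv; split; [|split].
  - apply (is_derive_comp_ex_diff_n (fun x y => c1 (r x y)) n D); trivial.
    intros a b Hab; apply (Hr a b Hab).
  - apply (is_derive_comp_ex_diff_n (fun x y => c2 (r x y)) n D); trivial.
    intros a b Hab; apply (Hr a b Hab).
  - apply (is_derive_comp_ex_diff_n (fun x y => c3 (r x y)) n D); trivial.
    intros a b Hab; apply (Hr a b Hab).
Qed.

Theorem proposition4p2
  (D : R * R -> Prop) (r : R -> R -> R3) (u v : R -> R) (t0 t1 : R)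
  (D_open : open D)
  (r_C3 : Cn_surface 3 r D)
  (r_regular : regular_net r D)
  (u_C3 : Cn_on_interval 3 u t0 t1)
  (v_C3 : Cn_on_interval 3 v t0 t1)
  (curve_in_D : forall s : R, t0 < s < t1 -> D (u s, v s))
  (triple_neq0 : forall s : R, t0 < s < t1 ->
     dot (cross (curve_derive_n (curve_on r u v) 1 s)
                (curve_derive_n (curve_on r u v) 2 s))
         (curve_derive_n (curve_on r u v) 3 s) <> 0)
  (t : R) (t_in : t0 < t < t1) :
  (exists delta : R, 0 < delta /\ t + delta <= t1 /\
     forall h : R, 0 < h < delta ->
       r (u (t + h)) (v (t + h)) <> r (u t) (v t) /\
       is_derive (dist_P (curve_on r u v) t) h
         (/ length3 (minus3 (r (u (t + h)) (v (t + h))) (r (u t) (v t))) *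
          dot (minus3 (r (u (t + h)) (v (t + h))) (r (u t) (v t)))
              (plus3
                 (scal3 (Derive u (t + h)) (partial_u r (u (t + h)) (v (t + h))))
                 (scal3 (Derive v (t + h)) (partial_v r (u (t + h)) (v (t + h)))))))
  /\
  is_right_derive (dist_P (curve_on r u v) t) 0
    (length3
       (plus3 (scal3 (Derive u t) (partial_u r (u t) (v t)))
              (scal3 (Derive v t) (partial_v r (u t) (v t))))).
Proof.
  assert (Hd : forall s, t0 < s < t1 -> is_derive3 (curve_on r u v) s
    (plus3 (scal3 (Derive u s) (partial_u r (u s) (v s)))
           (scal3 (Derive v s) (partial_v r (u s) (v s))))).
  (* With [n = 2], [S n] is the order in [r_C3]; the case [k = 1] of [u_C3] and [v_C3] is ordinary
     differentiability. *)
  { intros s Hs; apply (curve_on_derive 2 D); auto.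
    - exact (proj1 (u_C3 1%nat s ltac:(lia) Hs)).
    - exact (proj1 (v_C3 1%nat s ltac:(lia) Hs)). }
  pose proof (Hd t t_in) as Ht.
  split; [|now apply dist_P_right_derive].
  assert (Hw : curve_derive_n (curve_on r u v) 1 t <> zero3).
  { intros H0; apply (triple_neq0 t t_in).
    now rewrite H0, cross_zero_l, dot_zero_l. }
  rewrite (curve_derive_1_unique _ _ _ Ht) in Hw.
  destruct (eventually_PQ_neq0 _ _ _ Ht Hw) as [d Hne].
  (* The bound [d] keeps Q away from P, and [t1 - t] keeps [t + h] inside the parameter interval. *)
  exists (Rmin d (t1 - t)); pose proof (cond_pos d).
  pose proof (Rmin_l d (t1 - t)); pose proof (Rmin_r d (t1 - t)).
  split; [apply Rmin_pos; lra|]; split; [lra|]; intros h Hh.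
  assert (HPQ : PQ (curve_on r u v) t h <> zero3).
  { apply Hne; [|lra].
    change (Rabs (h - 0) < d); rewrite Rabs_pos_eq; lra. }
  split.
  - intros Heq; apply HPQ; unfold PQ, curve_on, minus3.
    now rewrite Heq, minus_eq_zero.
  - apply (dist_P_derive (curve_on r u v)); [apply Hd; lra | exact HPQ].
Qed.
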